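(* Let $-1<q<1$, let $n\ge 1$, let $f_1,\dots,f_n\in H_0$, and let $\xi_i=\phi(f_i)$ ($i=1,\dots,n$) be the corresponding $q$-Gaussian random variables. Then $$:\!\xi_1\cdots\xi_n\!:\;=\sum_{\gamma\in\mathsf F(n)}(-1)^{\#(\gamma)}\,q^{a(\gamma)}\,v(\gamma).$$
   Context: **$q$-Fock space.** $H_0$ is a real Hilbert space and $H$ its complexification; $-1<q<1$ is fixed (convention $0^0=1$). On the algebraic direct sum $\mathcal F_q^{\rm alg}(H)=\mathbb C\Omega\oplus H\oplus H^{\otimes 2}\oplus\cdots$ (algebraic tensor powers, $\Omega$ a unit vector) one defines a hermitian inner product (linear in the first variable) by $$\langle f_1\otimes\cdots\otimes f_m,\,g_1\otimes\cdots\otimes g_n\rangle=\delta_{mn}\sum_{\pi\in S_n}\langle f_1,g_{\pi(1)}\rangle\cdots\langle f_n,g_{\pi(n)}\rangle\,q^{\iota(\pi)},$$ where $\iota(\pi)=\#\{(i,j):1\le i<j\le n,\ \pi(i)>\pi(j)\}$. The $q$-Fock space $\mathcal F_q(H)$ is the completion. **Operators.** For $f\in H_0$, $a^+(f)$ and $a^-(f)$ are the bounded operators on $\mathcal F_q(H)$ (adjoints of each other) determined by $a^+(f)\Omega=f$, $a^+(f)(f_1\otimes\cdots\otimes f_n)=f\otimes f_1\otimes\cdots\otimes f_n$, and $a^-(f)\Omega=0$, $a^-(f)(f_1\otimes\cdots\otimes f_n)=\sum_{i=1}^n q^{i-1}\langle f,f_i\rangle f_1\otimes\cdots\otimes\widehat{f_i}\otimes\cdots\otimes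 f_n$, where for $f\in H_0$ the map $\langle f,\cdot\rangle$ here denotes the complex-linear extension to $H$ of the real inner product with $f$, and $\widehat{f_i}$ means that $f_i$ is omitted (the empty tensor being $\Omega$). The $q$-Gaussians are the operators $\phi(f)=a^+(f)+a^-(f)$, $f\in H_0$. For bounded operators $b$ on $\mathcal F_q(H)$ set $\mathbb E(b)=\langle b\Omega,\Omega\rangle$; in particular $\mathbb E(\phi(f)\phi(g))=\langle f,g\rangle$ for $f,g\in H_0$. **$q$-Wick product.** For $\xi_i=\phi(f_i)$, $f_i\in H_0$, $$:\!\xi_1\cdots\xi_n\!:\;=W(f_1,\dots,f_n)=\sum a^+(f_{i_1})\cdots a^+(f_{i_k})\,a^-(f_{j_1})\cdots a^-(f_{j_l})\,q^{\iota(I,J)},$$ the sum over all (possibly empty) $I=\{i_1<\dots<i_k\}$, $J=\{j_1<\dots<j_l\}$ with $I\sqcup J=[n]=\{1,\dots,n\}$, where $\iota(I,J)=\#\{(r,s):i_r>j_s\}$. **Feynman diagrams.** A Feynman diagram $\gamma$ on a finite linearly ordered set $S$ is a partition of $S$ into one- and two-element sets; it is identified with the set of its two-element blocks written as ordered pairs $(i,j)$ with $i<j$; the elements in one-element blocks are called singletons. $\mathsf F(n)$ is the set of all Feynman diagrams on $[n]$ (including the one with no pairs). $\#(\gamma)$ is the number of pairs in $\gamma$. For $(i,j)\in\gamma$: $c_l(i,j)$ is the number of pairs $(k,l)\in\gamma$ with $k<i<l<j$; $g(i,j)$ is the number of $k\in S$ with $i<k<j$; $a(i,j)=g(i,j)-c_l(i,j)$;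 and $a(\gamma)=\sum_{(i,j)\in\gamma}a(i,j)$. Finally, for $\gamma=\{(i_1,j_1),\dots,(i_p,j_p)\}\in\mathsf F(n)$ with singletons $h_1<\dots<h_r$, $$v(\gamma)=\mathbb E(\xi_{i_1}\xi_{j_1})\cdots\mathbb E(\xi_{i_p}\xi_{j_p})\,\xi_{h_1}\cdots\xi_{h_r},$$ an operator on $\mathcal F_q(H)$ (an empty product of operators is the identity $I$). *)

(* Defs.v *)
From HB Require Import structures.
From mathcomp Require Import all_boot all_order all_algebra.
From mathcomp Require Import fingroup perm sesquilinear.
From mathcomp Require Import complex.
From mathcomp Require Import all_classical all_reals all_analysis.

Set Implicit Arguments.
Unset Strict Implicit.
Unset Printing Implicit Defensive.

Import Order.TTheory GRing.Theory Num.Theory.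
Import numFieldNormedType.Exports.
Import complex.ComplexField.

Local Open Scope ring_scope.
Local Open Scope complex_scope.

(* [theta] is [idfun] for real Hilbert spaces and the conjugation for complex
   ones; the form is linear in its first argument and theta-linear in the
   second one. *)
Record hilbert (K : numFieldType) (theta : K -> K) := Hilbert {
  hilbert_sort :> completeNormedModType K ;
  hdot : {dot hilbert_sort for theta} ;
  hdot_norm : forall x : hilbert_sort, hdot x x = `|x| ^+ 2 }.

Notation realHilbert R := (hilbert (@idfun (Real.sort R))) (only parsing).
Notation complexHilbert R := (hilbert (@Num.conj R[i])) (only parsing).

(* The pair (x, y) stands for x + i y. *)
Definition complexification (R : realType) (V : lmodType R) : Type :=
  (V * V)%type.

Section Complexification.
Variables (R : realType) (V : lmodType R).
Local Notation VC := (complexification V).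

HB.instance Definition _ := GRing.Zmodule.copy VC (V * V)%type.

Definition cscale (c : R[i]) (x : VC) : VC :=
  (complex.Re c *: x.1 - complex.Im c *: x.2,
   complex.Re c *: x.2 + complex.Im c *: x.1).

Fact cscaleA a b x : cscale a (cscale b x) = cscale (a * b) x.
Proof.
case: a b x => [a a'] [b b'] [x y]; rewrite /cscale /=; congr pair.
- rewrite scalerBr scalerDr !scalerA scalerBl scalerDl !opprD.
  by rewrite [X in _ + X = _]addrC addrACA.
- rewrite scalerBr scalerDr !scalerA scalerBl scalerDl.
  by rewrite [X in _ + X = _]addrC addrACA.
Qed.

Fact cscale1 : left_id 1 cscale.
Proof.
by case=> x y; rewrite /cscale /= !scale1r !scale0r subr0 addr0.
Qed.

Fact cscaleDr : right_distributive cscale +%R.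
Proof.
move=> [a b] [x y] [u v]; rewrite /cscale /=; congr pair => /=.
- by rewrite !scalerDr opprD addrACA.
- by rewrite !scalerDr addrACA.
Qed.

Fact cscaleDl x : {morph cscale^~ x : a b / a + b}.
Proof.
case: x => x y [a b] [c d]; rewrite /cscale /=; congr pair => /=.
- by rewrite !scalerDl opprD addrACA.
- by rewrite !scalerDl addrACA.
Qed.

HB.instance Definition _ := GRing.Zmodule_isLmodule.Build R[i] VC
  cscaleA cscale1 cscaleDr cscaleDl.

End Complexification.

Section QFockSpace.
Variables (R : realType) (H0 : realHilbert R).

Local Notation H := (complexification H0).

Definition embed (f : H0) : H := (f, 0).

(* <x + iy, u + iv> *)
Definition cdot (h k : H) : R[i] :=
  (hdot H0 h.1 k.1 + hdot H0 h.2 k.2) +i*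
  (hdot H0 h.2 k.1 - hdot H0 h.1 k.2).

(* The complex-linear extension to H of the real functional <f, .>. *)
Definition rcdot (f : H0) (h : H) : R[i] := hdot H0 f h.1 +i* hdot H0 f h.2.

Definition inversions n (s : 'S_n) : nat :=
  #|[set p : 'I_n * 'I_n | (p.1 < p.2)%N && (s p.2 < s p.1)%N]|.

Definition qgram (q : R) (s t : seq H) : R[i] :=
  if size s == size t then
    \sum_(w : 'S_(size s))
      (\prod_(i < size s) cdot s`_i t`_(w i)) * q%:C ^+ inversions w
  else 0.

(* A Hilbert completion of the algebraic Fock space for the q-inner product.
   [tensor [:: h1; ...; hn]] is the image of h1 (x) ... (x) hn and
   [tensor [::]] that of the vacuum.  By the universal property of the algebraic
   tensor powers, a linear map from the algebraic Fock space is a multilinear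
   family [tensor]; [tensor_gram] says that this map is isometric and
   [tensor_dense] that its range is dense.  These data determine the space up
   to a unique unitary isomorphism preserving [tensor]. *)
Record qFock (q : R) := QFock {
  fock :> complexHilbert R ;
  tensor : seq H -> fock ;
  tensor_linear : forall (s t : seq H) (c : R[i]) (h k : H),
    tensor (s ++ (c *: h + k) :: t) =
      c *: tensor (s ++ h :: t) + tensor (s ++ k :: t) ;
  tensor_gram : forall s t : seq H,
    hdot fock (tensor s) (tensor t) = qgram q s t ;
  tensor_dense : dense [set x : fock | exists l : seq (R[i] * seq H),
    x = \sum_(p <- l) p.1 *: tensor p.2]%classic }.

Variables (q : R) (F : qFock q).

Definition vacuum : F := tensor F [::].

Definition bounded_operator (b : F -> F) : Prop :=
  linear b /\ exists M : R[i], forall x : F, `|b x| <= M * `|x|.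

Definition is_creation (f : H0) (b : F -> F) : Prop :=
  bounded_operator b /\
  forall s : seq H, b (tensor F s) = tensor F (embed f :: s).

Definition is_annihilation (f : H0) (b : F -> F) : Prop :=
  bounded_operator b /\
  forall s : seq H, b (tensor F s) =
    \sum_(i < size s) (q%:C ^+ i * rcdot f s`_i) *:
      tensor F (take i s ++ drop i.+1 s).

Definition expect (b : F -> F) : R[i] := hdot F (b vacuum) vacuum.

(* Big products of operators are taken in increasing order of the indices. *)
Definition opmul (b c : F -> F) : F -> F := b \o c.

Variables (ap am : H0 -> F -> F).

Definition qgauss (f : H0) : F -> F := ap f \+ am f.

Definition crossings n (I : {set 'I_n}) : nat :=
  #|[set p : 'I_n * 'I_n | [&& p.1 \in I, p.2 \notin I & (p.2 < p.1)%N]]|.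

Definition wick n (f : 'I_n -> H0) : F -> F :=
  \sum_(I : {set 'I_n})
    q%:C ^+ crossings I *:
      opmul (\big[opmul/idfun]_(i < n | i \in I) ap (f i))
            (\big[opmul/idfun]_(j < n | j \notin I) am (f j)).

Section Feynman.
Variable n : nat.

Definition feynman : {set {set {set 'I_n}}} :=
  [set g : {set {set 'I_n}} | finset.partition g [set: 'I_n] &
           [forall B in g, (#|B| == 1)%N || (#|B| == 2)%N]].

Implicit Type g : {set {set 'I_n}}.

Definition pairs g : {set 'I_n * 'I_n} :=
  [set p : 'I_n * 'I_n | (p.1 < p.2)%N && ([set p.1; p.2] \in g)].

Definition singletons g : {set 'I_n} := [set h | [set h] \in g].

Definition left_crossings g (p : 'I_n * 'I_n) : nat :=
  #|[set r in pairs g | [&& r.1 < p.1, p.1 < r.2 & r.2 < p.2]%N]|.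

Definition gap (p : 'I_n * 'I_n) : nat := #|[set k : 'I_n | (p.1 < k < p.2)%N]|.

(* The subtraction of naturals is exact, by [left_crossings_le_gap]. *)
Definition pair_weight g (p : 'I_n * 'I_n) : nat :=
  (gap p - left_crossings g p)%N.

Definition weight g : nat := (\sum_(p in pairs g) pair_weight g p)%N.

Lemma left_crossings_le_gap g p :
  g \in feynman -> (left_crossings g p <= gap p)%N.
Proof.
rewrite inE => /andP[/and3P[_ /finset.trivIsetP tg _] _].
rewrite /left_crossings /gap.
rewrite -(@card_in_imset _ _ (fun r : 'I_n * 'I_n => r.2)).
  apply/subset_leq_card/fintype.subsetP => k /imsetP[r].
  by rewrite !inE => /andP[_ /and3P[_ h1 h2]] ->; rewrite h1 h2.
move=> [a b] [c d]; rewrite !inE /=.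
move=> /andP[/andP[ab abg] _] /andP[/andP[cd cdg] _] bd; subst d.
congr pair; apply/eqP; apply: contraT => ac.
have ne : [set a; b] != [set c; b].
  apply/eqP => /setP/(_ a); rewrite !inE eqxx /= (negbTE ac) /=.
  by move/esym/eqP => eab; rewrite eab ltnn in ab.
have /disjoint_setI0/setP/(_ b) := tg _ _ abg cdg ne.
by rewrite !inE eqxx !orbT.
Qed.

Variable f : 'I_n -> H0.

Definition feynman_value g : F -> F :=
  (\prod_(p in pairs g)
     expect (opmul (qgauss (f p.1)) (qgauss (f p.2)))) *:
  \big[opmul/idfun]_(h < n | h \in singletons g) qgauss (f h).

End Feynman.
End QFockSpace.

(* Main.v *)
Require Import Defs.
From HB Require Import structures.
From mathcomp Require Import all_boot all_order all_algebra.
From mathcomp Require Import sesquilinear fingroup perm.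
From mathcomp Require Import complex.
From mathcomp Require Import all_classical all_reals all_analysis.
From mathcomp Require Import seq fintype finset.
Import Order.TTheory GRing.Theory Num.Theory.
Local Open Scope ring_scope.
Local Open Scope complex_scope.

Set Implicit Arguments.
Unset Strict Implicit.
Unset Printing Implicit Defensive.

(* Both sides are generalized to an arbitrary index set S of [n], and shown to
   satisfy the same recursion when an index m smaller than all of S is added:
     W(m, S) = xi_m W(S) - sum_(j in S) q^#{k in S | k < j} <f_m, f_j> W(S - j).
   For the Wick product, split according to whether m carries a creation or an
   annihilation operator; in the latter case move a^-(f_m) to the left through
   the creation operators by a^-(f) a^+(g) = <f, g> + q a^+(g) a^-(f).  For the
   sum over Feynman diagrams, split according to whether m is a singleton or
   paired with j; removing its block leaves the weights a of the other pairs
   unchanged.  The commutation relation is checked on elementary tensors and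
   extended by boundedness and density. *)

(** * Index sets enlarged by a new smallest element *)

Section MinElement.
Variable n : nat.
Implicit Types (m : 'I_n) (S : {set 'I_n}).

(** Both lists are strictly increasing and have the same members, hence coincide. *)
Lemma enum_setU1_min m S :
  (forall i, i \in S -> (m < i)%N) -> enum (m |: S) = m :: enum S.
Proof.
move=> mS.
have sortedE (A : {set 'I_n}) : sorted (fun i j : 'I_n => (i < j)%N) (enum A).
  have -> : enum A = filter (mem A) (enum 'I_n) by rewrite enumT.
  apply: sorted_filter => [a b c|]; first exact: ltn_trans.
  by have := iota_ltn_sorted 0 n; rewrite -val_enum_ord sorted_map.
apply: (@irr_sorted_eq _ (fun i j : 'I_n => (i < j)%N)).
- by move=> a b c; exact: ltn_trans.
- by move=> a; exact: ltnn.
- exact: sortedE.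
- rewrite /= path_min_sorted ?sortedE //.
  by apply/allP => i; rewrite mem_enum => /mS.
- by move=> i; rewrite inE !mem_enum in_setU1.
Qed.

(** The recursion at [m |: S] refers to S and to each [S :\ j], so the induction hypothesis must
    cover all subsets of S. *)
Lemma ord_set_ind (P : {set 'I_n} -> Prop) :
  P set0 ->
  (forall m S, (forall i, i \in S -> (m < i)%N) ->
     (forall T : {set 'I_n}, T \subset S -> P T) -> P (m |: S)) ->
  forall S, P S.
Proof.
move=> P0 PU S; have [k] := ubnP #|S|; elim: k S => // k IH S leSk.
have [->//|[i0 i0S]] := set_0Vmem S.
pose m := [arg min_(i < i0 in S) (i : nat)].
have [mS minm] : m \in S /\ (forall i, i \in S -> (m <= i)%N).
  by rewrite /m; case: arg_minnP.
rewrite -(setD1K mS); apply: PU => [i|T TS].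
  rewrite !inE => /andP[im iS]; rewrite ltn_neqAle minm // andbT.
  by rewrite eq_sym.
apply: IH; apply: leq_ltn_trans (subset_leq_card TS) _.
by rewrite (cardsD1 m) mS add1n ltnS in leSk.
Qed.

Lemma min_notin m S : (forall i, i \in S -> (m < i)%N) -> m \notin S.
Proof. by move=> mS; apply/negP => /mS; rewrite ltnn. Qed.

(** A sum of truth values, rather than a cardinal, can be split by the rules for big operators. *)
Definition below S j : nat := \sum_(k in S) (k < j)%N.

End MinElement.

(** * Sums over subsets, split by membership of one element *)

Section SubsetSums.
Variables (V : nmodType) (T : finType).
Implicit Types (A S I : {set T}) (G : {set T} -> V).

Lemma big_subset_mem (i : T) S G : i \in S ->
  \sum_(I : {set T} | (I \subset S) && (i \in I)) G I =
  \sum_(I : {set T} | I \subset S :\ i) G (i |: I).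
Proof.
move=> iS; rewrite (reindex_onto (fun I => i |: I) (fun I => I :\ i)) /=.
  apply: eq_bigl => I; rewrite subUset sub1set iS setU11 subsetD1 andbT /=.
  congr andb; apply/eqP/idP => [<-|/setU1K//]; by rewrite setD11.
by move=> I /andP[_ iI]; rewrite setD1K.
Qed.

Lemma big_subset_setU1 (i : T) S G : i \notin S ->
  \sum_(I : {set T} | I \subset i |: S) G I =
  \sum_(I : {set T} | I \subset S) G (i |: I) +
  \sum_(I : {set T} | I \subset S) G I.
Proof.
move=> iS; rewrite (bigID (fun I : {set T} => i \in I)) /=.
rewrite big_subset_mem ?setU11// setU1K//; congr (_ + _).
apply: eq_bigl => I; rewrite -subsetD1 setU1K//.
Qed.

End SubsetSums.

(** * Feynman diagrams on a subset and the removal of one block *)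

Section FeynmanDiagrams.
Variable n : nat.
Implicit Types (S B : {set 'I_n}) (g : {set {set 'I_n}}) (m i j : 'I_n)
  (p : 'I_n * 'I_n).

Definition feynman_on S : {set {set {set 'I_n}}} :=
  [set g | partition g S & [forall B in g, (#|B| == 1)%N || (#|B| == 2)%N]].

(** This is a(g) for the ordered set S: gaps are counted inside S, so deleting a block also deletes
    its points from the gaps. *)
Definition weight_on S g : nat :=
  (\sum_(p in pairs g)
     (#|[set k in S | (p.1 < k < p.2)%N]| - left_crossings g p))%N.

Lemma feynman_on_partition S g : g \in feynman_on S -> partition g S.
Proof. by rewrite inE => /andP[]. Qed.

Lemma feynman_on_card S g B : g \in feynman_on S -> B \in g ->
  (#|B| == 1)%N || (#|B| == 2)%N.
Proof. by rewrite inE => /andP[_ /forall_inP]; apply. Qed.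

Lemma pairs_sub S g p : g \in feynman_on S -> p \in pairs g ->
  [/\ p.1 \in S, p.2 \in S & (p.1 < p.2)%N].
Proof.
move=> gF; rewrite inE => /andP[lt12 /(partitionS (feynman_on_partition gF))].
by rewrite subUset !sub1set => /andP[].
Qed.

Lemma singletons_sub S g i : g \in feynman_on S ->
  i \in Defs.singletons g -> i \in S.
Proof.
move=> gF; rewrite inE => /(partitionS (feynman_on_partition gF)).
by rewrite sub1set.
Qed.

Lemma pairs0 : pairs (set0 : {set {set 'I_n}}) = set0.
Proof. by apply/setP => p; rewrite !inE andbF. Qed.

Lemma singletons0 : Defs.singletons (set0 : {set {set 'I_n}}) = set0.
Proof. by apply/setP => p; rewrite !inE. Qed.

Lemma pairsU_singleton m g : pairs ([set m] |: g) = pairs g.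
Proof.
apply/setP => p; rewrite !inE; case: ltnP => //= lt12.
case: eqP => //= E; have := cards2 p.1 p.2; rewrite E cards1.
by rewrite (contraTneq _ lt12)// => ->; rewrite ltnn.
Qed.

Lemma singletonsU_singleton m g :
  Defs.singletons ([set m] |: g) = m |: Defs.singletons g.
Proof.
apply/setP => i; rewrite !inE; congr (_ || _).
by apply/eqP/eqP => [/set1_inj|->].
Qed.

Lemma set2_min_inj m j p : (m < j)%N -> (p.1 < p.2)%N ->
  ([set p.1; p.2] == [set m; j]) = (p == (m, j)).
Proof.
case: p => a b mj /= ab; apply/eqP/eqP => [E|[-> ->]//].
move: (set21 a b) (set22 a b); rewrite E !inE.
move=> /orP[]/eqP aE /orP[]/eqP bE; move: ab; rewrite aE bE ?ltnn//.
by rewrite ltnNge (ltnW mj).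
Qed.

Lemma pairsU_pair m j g : (m < j)%N ->
  pairs ([set m; j] |: g) = (m, j) |: pairs g.
Proof.
move=> mj; apply/setP => p; rewrite !inE; case: ltnP => /= lt12.
  by rewrite set2_min_inj.
by rewrite orbF; case: eqP => // pE; move: lt12; rewrite pE /= leqNgt mj.
Qed.

Lemma singletonsU_pair m j g : m != j ->
  Defs.singletons ([set m; j] |: g) = Defs.singletons g.
Proof.
move=> mj; apply/setP => i; rewrite !inE.
by case: eqP => //= E; have := cards2 m j; rewrite -E cards1 mj.
Qed.

(** The value [j = m] encodes a singleton, so a single index j distinguishes all possible blocks of
    m. *)
Lemma feynman_on_partner S g m : g \in feynman_on S -> m \in S ->
  exists2 j, j \in S & forall k, ([set m; k] \in g) = (k == j).
Proof.
move=> gF mS; have gP := feynman_on_partition gF.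
have [/eqP cS tI _] := and3P gP.
have mc : m \in cover g by rewrite cS.
have Bg := pblock_mem mc; have mB : m \in pblock g m by rewrite mem_pblock.
have [j BE] : exists j, pblock g m = [set m; j].
  case/orP: (feynman_on_card gF Bg) => [/cards1P[a aE]|/cards2P[a [b [_ abE]]]].
    by exists m; move: mB; rewrite aE inE => /eqP->; rewrite setUid.
  move: mB; rewrite abE !inE => /orP[]/eqP->; first by exists b.
  by exists a; rewrite setUC.
exists j; first by rewrite (subsetP (partitionS gP Bg)) // BE set22.
move=> k; apply/idP/eqP => [kg|->]; last by rewrite -BE.
have kE : [set m; k] = [set m; j].
  by rewrite -BE (def_pblock tI kg) ?set21.
have := set22 m k; rewrite kE !inE => /orP[]/eqP // km.
by have := set22 m j; rewrite -kE km !inE orbb => /eqP.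
Qed.

(** Deleting B and adding it back are mutually inverse; a diagram on [S :\: B] cannot contain B,
    because B is nonempty. *)
Lemma big_feynman_on_block (V : nmodType) S B (G : {set {set 'I_n}} -> V) :
  B \subset S -> (#|B| == 1)%N || (#|B| == 2)%N ->
  \sum_(g in feynman_on S | B \in g) G g =
  \sum_(g in feynman_on (S :\: B)) G (B |: g).
Proof.
move=> BS cB; have B0 : B != set0 by rewrite -card_gt0; case/orP: cB => /eqP->.
rewrite (reindex_onto (fun g => B |: g) (fun g => g :\ B)) /=; last first.
  by move=> g /andP[_ Bg]; rewrite setD1K.
apply: eq_bigl => g; rewrite setU11 andbT; apply/andP/idP.
  case=> gF /eqP <-; rewrite inE partitionD1 ?setU11 ?feynman_on_partition//=.
  by apply/forall_inP => C /setD1P[_ Cg]; exact: feynman_on_card gF Cg.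
move=> gF; have gP := feynman_on_partition gF.
have BNg : B \notin g.
  apply: contraNN B0 => /(partitionS gP); rewrite subsetD => /andP[_].
  by rewrite -setI_eq0 setIid.
rewrite setU1K// eqxx; split=> //; rewrite inE; apply/andP; split.
  have <- : B :|: (S :\: B) = S by rewrite -{1}(setIidPr BS) setID.
  by rewrite partitionU1 // disjoint_sym disjoints_subset setDE subsetIr.
by apply/forall_inP => C /setU1P[->//|/(feynman_on_card gF)].
Qed.

(** The point m precedes every left endpoint, so it lies in no gap. *)
Lemma weight_onU_singleton m S g : (forall i, i \in S -> (m < i)%N) ->
  g \in feynman_on S -> weight_on (m |: S) ([set m] |: g) = weight_on S g.
Proof.
move=> mS gF; rewrite /weight_on /left_crossings pairsU_singleton.
apply: eq_bigr => p pg; congr (_ - _)%N; apply: eq_card => k; rewrite !inE.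
case: (k =P m) => //= ->; have [/mS + _ _] := pairs_sub gF pg.
by case: ltngtP => //=; rewrite andbF.
Qed.

(* Removing the pair (m, j) lowers the gap and the number of left crossings of
   (k, l) by one each when k < j < l, and otherwise changes neither. *)
Lemma weight_onU_pair m S j g : (forall i, i \in S -> (m < i)%N) -> j \in S ->
  g \in feynman_on (S :\ j) ->
  weight_on (m |: S) ([set m; j] |: g) = (below S j + weight_on (S :\ j) g)%N.
Proof.
move=> mS jS gF; have mj := mS _ jS.
have mnS := min_notin mS.
have pgS p : p \in pairs g ->
    [/\ (m < p.1)%N, (p.1 < p.2)%N, p.1 != j & p.2 != j].
  by move=> /(pairs_sub gF)[/setD1P[-> /mS->] /setD1P[-> _] ->].
have mjNg : (m, j) \notin pairs g.
  by apply/negP => /pgS[]; rewrite ltnn.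
rewrite /weight_on pairsU_pair// big_setU1//=; congr (_ + _)%N.
  (* No pair starts before m, so (m, j) has no left crossings and its weight is its whole gap,
     [below S j]. *)
  rewrite /left_crossings eq_card0 ?subn0 => [|r]; last first.
    rewrite inE pairsU_pair// in_setU1.
    apply/negP => /andP[/orP[/eqP->|/pgS[lt _ _ _]]] /=; first by rewrite ltnn.
    by rewrite ltnNge ltnW.
  rewrite /below -sum1dep_card big_mkcond /= [RHS]big_mkcond.
  apply: eq_bigr => k _; rewrite !inE; case: (k =P m) => [->|_] /=.
    by rewrite ltnn (negbTE mnS).
  by case: (boolP (k \in S)) => //= /mS->; case: (k < j)%N.
apply: eq_bigr => p pg; have [mp p12 p1j p2j] := pgS _ pg.
have -> : #|[set k in m |: S | (p.1 < k < p.2)%N]| =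
    ((p.1 < j < p.2)%N + #|[set k in S :\ j | (p.1 < k < p.2)%N]|)%N.
  rewrite (cardsD1 j) !inE jS orbT /=; congr (_ + _)%N.
  apply: eq_card => k; rewrite !inE; case: (k =P m) => [->|_] /=.
    by rewrite (ltnNge p.1) (ltnW mp) !andbF.
  by rewrite andbA.
have -> : left_crossings ([set m; j] |: g) p =
    ((p.1 < j < p.2)%N + left_crossings g p)%N.
  rewrite /left_crossings (cardsD1 (m, j)) pairsU_pair// !inE eqxx mp /=.
  congr (_ + _)%N; apply: eq_card => r; rewrite !inE.
  case: (r =P (m, j)) => [->|_] //=.
  by move: mjNg; rewrite !inE mp /= => /negbTE->.
by rewrite subnDl.
Qed.

End FeynmanDiagrams.

(** * The common recursion, for abstract linear maps with the q-commutation relation *)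

Section WickFeynman.
Variables (K : comNzRingType) (V : lmodType K) (n : nat).
Variables (q : K) (e : 'I_n -> 'I_n -> K) (ap am : 'I_n -> {linear V -> V}).
Hypothesis qcomm : forall i j y,
  am i (ap j y) = e i j *: y + q *: ap j (am i y).
Implicit Types (S I J : {set 'I_n}) (m i j : 'I_n) (x y : V).

(** The exponent iota(I, J) of the Wick product. *)
Definition cross I J : nat := \sum_(i in I) below J i.

(** The ordered product of operators evaluated at a vector; the smallest index acts last. *)
Definition compose (u : 'I_n -> V -> V) S x : V :=
  foldr (fun i => u i) x (enum S).

Lemma compose0 u x : compose u set0 x = x.
Proof. by rewrite /compose enum_set0. Qed.

Lemma composeU1 u m S x : (forall i, i \in S -> (m < i)%N) ->
  compose u (m |: S) x = u m (compose u S x).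
Proof. by move=> mS; rewrite /compose enum_setU1_min. Qed.

Lemma below_min m S : (forall i, i \in S -> (m < i)%N) -> below S m = 0%N.
Proof. by move=> mS; rewrite /below big1 // => i /mS; case: ltngtP. Qed.

Lemma belowU1 i S j : i \notin S -> below (i |: S) j = ((i < j) + below S j)%N.
Proof. by move=> iS; rewrite /below big_setU1. Qed.

Lemma belowU1r i S : below (i |: S) i = below S i.
Proof.
rewrite /below [RHS]big_mkcond [LHS]big_mkcond; apply: eq_bigr => k _.
by rewrite !inE; case: eqP => //= ->; rewrite ltnn; case: ifP.
Qed.

Lemma crossU1l i I J : i \notin I ->
  cross (i |: I) J = (below J i + cross I J)%N.
Proof. by move=> iI; rewrite /cross big_setU1. Qed.

Lemma crossU1r m S I J : (forall i, i \in S -> (m < i)%N) ->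
  I \subset S -> m \notin J ->
  cross I (m |: J) = (#|I| + cross I J)%N.
Proof.
move=> mS IS mJ; rewrite /cross (eq_bigr (fun i => (1 + below J i)%N)).
  by rewrite big_split /= sum1_card.
by move=> i iI; rewrite belowU1// mS// (subsetP IS).
Qed.

Lemma below_split S I i : I \subset S ->
  (below I i + below (S :\: I) i = below S i)%N.
Proof.
move=> IS; rewrite /below [RHS](big_setID I) /=.
by rewrite (setIidPr IS).
Qed.

(** Each creation operator passed costs a factor q. A contraction with j happens after passing the
    operators of I below j; the uncontracted term passes all of I. *)
Lemma am_compose i I y :
  am i (compose (fun k => ap k) I y) =
  q ^+ #|I| *: compose (fun k => ap k) I (am i y) +
  \sum_(j in I) (q ^+ below I j * e i j) *: compose (fun k => ap k) (I :\ j) y.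
Proof.
elim/ord_set_ind: I => [|m I mI IH].
  by rewrite cards0 expr0 scale1r !compose0 big_set0 addr0.
have mnI := min_notin mI.
rewrite !composeU1 // qcomm IH ?subxx// cardsU1 mnI add1n exprS.
rewrite big_setU1 //= belowU1r below_min// expr0 mul1r setU1K//.
rewrite linearD linear_sum linearZ scalerDr !scalerA scaler_sumr.
rewrite addrCA; congr (_ + (_ + _)).
apply: eq_bigr => j jI.
rewrite linearZ scalerA belowU1// (mI _ jI) add1n exprS mulrA.
congr (_ *: _).
rewrite -[LHS](@composeU1 (fun k => ap k) m); last by move=> k /setD1P[_ /mI].
congr (compose _ _ _); apply/setP => k; rewrite !inE.
by case: (k =P m) => [->|//]; case: (m =P j) => [mj|//]; rewrite mj jI in mnI.
Qed.

Definition wick_on S x : V :=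
  \sum_(I : {set 'I_n} | I \subset S)
    q ^+ cross I (S :\: I) *:
      compose (fun k => ap k) I (compose (fun k => am k) (S :\: I) x).

(** If m annihilates, it crosses all of I, and the resulting q^#|I| is the factor in the
    uncontracted term of [am_compose]. These terms are therefore [am m (wick_on S x)] minus its
    contractions. *)
Lemma wick_onU1 m S x : (forall i, i \in S -> (m < i)%N) ->
  wick_on (m |: S) x = ap m (wick_on S x) + am m (wick_on S x) -
    \sum_(j in S) (q ^+ below S j * e m j) *: wick_on (S :\ j) x.
Proof.
move=> mS; have mnS := min_notin mS.
rewrite {1}/wick_on big_subset_setU1 // -addrA; congr (_ + _).
  rewrite linear_sum; apply: eq_bigr => I IS.
  have mI i : i \in I -> (m < i)%N by move/(subsetP IS)/mS.
  have -> : (m |: S) :\: (m |: I) = S :\: I.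
    apply/setP => k; rewrite !inE; case: (k =P m) => [->|//].
    by rewrite (negbTE mnS) !andbF.
  rewrite crossU1l ?min_notin// below_min ?linearZ ?composeU1//.
  by move=> i /setDP[/mS].
apply/esym/eqP; rewrite subr_eq; apply/eqP.
(* The middle expression is [am m (wick_on S x)] expanded by [am_compose]. *)
transitivity (\sum_(I : {set 'I_n} | I \subset S)
  (q ^+ cross I ((m |: S) :\: I) *: compose (fun k => ap k) I
      (compose (fun k => am k) ((m |: S) :\: I) x) +
  \sum_(j in I) (q ^+ (cross I (S :\: I) + below I j) * e m j) *:
      compose (fun k => ap k) (I :\ j) (compose (fun k => am k) (S :\: I) x))).
  rewrite linear_sum; apply: eq_bigr => I IS; rewrite linearZZ am_compose.
  have mI i : i \in I -> (m < i)%N by move/(subsetP IS)/mS.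
  have -> : (m |: S) :\: I = m |: (S :\: I).
    apply/setP => k; rewrite !inE; case: (k =P m) => [->|//].
    by rewrite (min_notin mI).
  rewrite (crossU1r mS)// ?inE ?(negbTE mnS) ?andbF// composeU1; last first.
    by move=> i /setDP[/mS].
  rewrite scalerDr scalerA addnC exprD; congr (_ + _).
  by rewrite scaler_sumr; apply: eq_bigr => j _; rewrite scalerA exprD mulrA.
rewrite big_split /=; congr (_ + _).
(* Fix the contracted index j first; the remaining creators then range over the subsets of
   [S :\ j]. *)
rewrite (exchange_big_dep (mem S)) /=; last by move=> I j IS /(subsetP IS).
apply: eq_bigr => j jS; rewrite big_subset_mem // scaler_sumr.
apply: eq_bigr => I; rewrite subsetD1 => /andP[IS jI].
rewrite setU1K// scalerA.
have -> : S :\: (j |: I) = (S :\ j) :\: I.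
  apply/setP => k; rewrite !inE negb_or.
  by case: (k \in I); rewrite ?andbF ?andbT.
congr (_ *: _); rewrite mulrAC -exprD; congr (_ ^+ _ * _).
(* Creators below j are passed by [am m], annihilators below j are crossed by the creator j;
   together they exhaust the elements of S below j. *)
have <- : (below I j + below ((S :\ j) :\: I) j = below S j)%N.
  have IS' : I \subset S :\ j by rewrite subsetD1 IS.
  by rewrite below_split// -belowU1r setD1K.
by rewrite crossU1l// belowU1r addnC addnA.
Qed.

Definition qgauss_on i y : V := ap i y + am i y.

Definition feynman_term S (g : {set {set 'I_n}}) x : V :=
  ((-1) ^+ #|pairs g| * q ^+ weight_on S g *
     \prod_(p in pairs g) e p.1 p.2) *:
  compose qgauss_on (Defs.singletons g) x.

Definition feynman_sum S x : V :=
  \sum_(g in feynman_on S) feynman_term S g x.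

(** A singleton m contributes the outermost factor [qgauss_on m]. A pair (m, j) contributes a sign,
    the covariance [e m j] and, by [weight_onU_pair], the power q^([below S j]). *)
Lemma feynman_sumU1 m S x : (forall i, i \in S -> (m < i)%N) ->
  feynman_sum (m |: S) x = qgauss_on m (feynman_sum S x) -
    \sum_(j in S) (q ^+ below S j * e m j) *: feynman_sum (S :\ j) x.
Proof.
move=> mS; have mnS := min_notin mS.
rewrite {1}/feynman_sum.
(* Exactly one j passes the inner condition for each g, so the inner sum only records the partner of
   m. *)
transitivity (\sum_(g in feynman_on (m |: S))
    \sum_(j in m |: S | [set m; j] \in g) feynman_term (m |: S) g x).
  apply: eq_bigr => g gF; have [j jS jE] := feynman_on_partner gF (setU11 m S).
  rewrite (big_pred1 j) // => k /=; rewrite jE.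
  by case: eqP => [->|]; rewrite ?jS ?andbF.
rewrite (exchange_big_dep (mem (m |: S))) /=; last by move=> g j _ /andP[].
rewrite big_setU1 //=; congr (_ + _).
  under eq_bigl => g do rewrite setU11 setUid /=.
  rewrite big_feynman_on_block ?cards1 ?sub1set ?setU11// setU1K//.
  rewrite /qgauss_on /feynman_sum !linear_sum -big_split /=.
  apply: eq_bigr => g gF; rewrite /feynman_term !linearZ -scalerDr.
  rewrite pairsU_singleton weight_onU_singleton// singletonsU_singleton.
  by rewrite composeU1 // => i /(singletons_sub gF)/mS.
rewrite -sumrN; apply: eq_bigr => j jS.
have mj := mS _ jS.
under eq_bigl => g do rewrite in_setU1 jS orbT /=.
have mjE : (m |: S) :\: [set m; j] = S :\ j.
  apply/setP => k; rewrite !inE negb_or; case: (k =P m) => [->|//] /=.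
  by rewrite (negbTE mnS) andbF.
have neq : m != j by apply: contraNneq mnS => ->.
rewrite big_feynman_on_block ?cards2 ?neq ?orbT// ?mjE; last first.
  by rewrite subUset !sub1set setU11 in_setU1 jS orbT.
rewrite scaler_sumr -sumrN; apply: eq_bigr => g gF.
rewrite /feynman_term (weight_onU_pair mS jS gF) (singletonsU_pair _ neq).
rewrite (pairsU_pair _ mj) cardsU1 big_setU1 /=; last first.
  by apply/negP => /(pairs_sub gF)[/setD1P[_]]; rewrite (negbTE mnS).
rewrite (_ : (m, j) \notin pairs g); last first.
  by apply/negP => /(pairs_sub gF)[/setD1P[_]]; rewrite (negbTE mnS).
rewrite scalerA -scaleNr; congr (_ *: _).
rewrite add1n exprS exprD.
move: (_ ^+ #|_|) (q ^+ below _ _) (q ^+ weight_on _ _) (\prod_(p in _) _).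
move=> a b c d; rewrite !mulN1r !mulNr; congr (- _).
by rewrite (mulrCA a) mulrACA.
Qed.

Lemma wick_on_feynman S x : wick_on S x = feynman_sum S x.
Proof.
elim/ord_set_ind: S x => [|m S mS IH] x.
  (* On the empty set there is one subset and one diagram, and both sides reduce to x. *)
  rewrite /wick_on (big_pred1 set0) => [|I]; last by rewrite subset0.
  rewrite /feynman_sum (big_pred1 set0) => [|g]; last first.
    rewrite inE partition_set0 /=; case: eqP => // ->.
    by apply/forall_inP => B; rewrite inE.
  rewrite /feynman_term /weight_on /cross !pairs0 !singletons0 set0D !big_set0.
  by rewrite cards0 !expr0 !mulr1 !compose0.
rewrite wick_onU1// feynman_sumU1// /qgauss_on !IH//.
by congr (_ - _); apply: eq_bigr => j _; rewrite IH// subD1set.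
Qed.

End WickFeynman.

(** * Bounded operators on the q-Fock space *)

Section Operators.
Variables (R : realType) (H0 : realHilbert R) (q : R) (F : qFock H0 q).
Implicit Types (b c : F -> F) (f g : H0) (x : F).

Lemma big_opmul n (u : 'I_n -> F -> F) (A : {set 'I_n}) x :
  (\big[@opmul R H0 q F/idfun]_(i < n | i \in A) u i) x = compose u A x.
Proof.
have -> : \big[@opmul R H0 q F/idfun]_(i < n | i \in A) u i =
    \big[@opmul R H0 q F/idfun]_(i <- enum A) u i.
  by rewrite -[LHS]big_filter [index_enum _]unlock.
rewrite /compose; elim: (enum A) => [|i s IH] /=; first by rewrite big_nil.
by rewrite big_cons /opmul /= IH.
Qed.

Definition linear_pack b (lb : linear b) : {linear F -> F} :=
  HB.pack b (GRing.isLinear.Build R[i] F F *:%R b lb).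

(** Provides a bound that can be divided by; the M in [bounded_operator] is any complex number. *)
Lemma bounded_operator_pos b : bounded_operator b ->
  exists2 M : R[i], 0 < M & forall x, `|b x| <= M * `|x|.
Proof.
case=> _ [M bM]; exists (`|M| + 1); first by rewrite ltr_wpDl.
move=> x; apply: le_trans (bM x) _.
(* The product dominates a norm, so it is real and nonnegative and equals its own norm. *)
have /ger0_norm <- : 0 <= M * `|x| by exact: le_trans (bM x).
by rewrite normrM normr_id ler_wpM2r// lerDl.
Qed.

Lemma bounded_operator_comp b c :
  bounded_operator b -> bounded_operator c -> bounded_operator (b \o c).
Proof.
move=> bb bc; have [M M0 bM] := bounded_operator_pos bb.
have [N _ cN] := bounded_operator_pos bc.
split; first by move=> k x y /=; rewrite bc.1 bb.1.
exists (M * N) => x; apply: le_trans (bM _) _.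
by rewrite -mulrA ler_wpM2l// ltW.
Qed.

Lemma bounded_operator_lincomb (k : R[i]) b c :
  bounded_operator b -> bounded_operator c ->
  bounded_operator (fun x => b x + k *: c x).
Proof.
move=> bb bc; have [M _ bM] := bounded_operator_pos bb.
have [N _ cN] := bounded_operator_pos bc.
split.
  move=> l x y; rewrite bc.1 bb.1 !scalerDr !scalerA (mulrC k) addrACA.
  by rewrite -!scalerA.
exists (M + `|k| * N) => x; apply: le_trans (ler_normD _ _) _.
by rewrite mulrDl lerD// normrZ -mulrA ler_wpM2l.
Qed.

Lemma bounded_operator_scale (k : R[i]) :
  bounded_operator (fun x : F => k *: x).
Proof.
split; first by move=> l x y; rewrite scalerDr !scalerA mulrC.
by exists `|k| => x; rewrite normrZ.
Qed.

(** The difference d vanishes on the span of the tensors. If d x were nonzero, density would give y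
    in that span closer to x than |d x| / M, while |d x| = |d (x - y)| is at most M |x - y|. *)
Lemma bounded_operator_ext b c :
  bounded_operator b -> bounded_operator c ->
  (forall s, b (tensor F s) = c (tensor F s)) -> b =1 c.
Proof.
move=> bb bc bcE x; apply/eqP; rewrite -subr_eq0; apply: contraT => nz.
pose d (y : F) := b y + (-1) *: c y.
have bd : bounded_operator d by exact: bounded_operator_lincomb.
have dE y : d y = linear_pack bd.1 y by [].
have [M M0 dM] := bounded_operator_pos bd.
have dx0 : 0 < `|d x| by rewrite normr_gt0 /d scaleN1r.
have r0 : 0 < `|d x| / M by rewrite divr_gt0.
have [||y [xy [l yE]]] := @tensor_dense _ _ _ F (ball x (`|d x| / M)).
- by exists x; exact: ballxx.
- exact: ball_open.
have dy : d y = 0.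
  rewrite yE dE linear_sum big1 // => p _.
  by rewrite linearZZ -dE /d bcE scaleN1r subrr scaler0.
have dxM : `|d x| <= M * `|x - y| by rewrite -[d x]subr0 -dy !dE -linearB -dE.
rewrite -ball_normE /= in xy.
have : `|d x| / M <= `|x - y| by rewrite ler_pdivrMr// mulrC.
by move=> /(lt_le_trans xy); rewrite ltxx.
Qed.

Variables (ap am : H0 -> F -> F).
Hypothesis hap : forall f, is_creation f (ap f).
Hypothesis ham : forall f, is_annihilation f (am f).

(** On a tensor headed by g, removing the head gives <f, g>, and every later removal is shifted by
    one place, whence the factor q. *)
Lemma annihilation_creation f g x :
  am f (ap g x) = (hdot H0 f g)%:C *: x + q%:C *: ap g (am f x).
Proof.
have [bf amE] := ham f; have [bg apE] := hap g.
apply: (@bounded_operator_ext (am f \o ap g)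
  (fun x => (hdot H0 f g)%:C *: x + q%:C *: ap g (am f x))).
- exact: bounded_operator_comp.
- apply: bounded_operator_lincomb; first exact: bounded_operator_scale.
  exact: bounded_operator_comp.
move=> s /=; rewrite apE !amE /= big_ord_recl /= expr0 mul1r drop0.
rewrite [rcdot _ _](_ : _ = (hdot H0 f g)%:C); last first.
  by rewrite /rcdot /= linear0r.
congr (_ + _).
have -> y : ap g y = linear_pack bg.1 y by [].
rewrite linear_sum scaler_sumr; apply: eq_bigr => i _.
by rewrite linearZZ /= apE scalerA exprS mulrA.
Qed.

(** The vector phi(f) phi(g) Omega is f (x) g + <f, g> Omega, and the two-fold tensor is orthogonal
    to the vacuum. *)
Lemma expect_qgauss f g :
  expect (opmul (qgauss ap am f) (qgauss ap am g)) = (hdot H0 f g)%:C.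
Proof.
have [bf amE] := ham f; have [bf' apE] := hap f.
have [_ amE'] := ham g; have [_ apE'] := hap g.
rewrite /expect /opmul /qgauss /vacuum /= amE' big_ord0 addr0 apE' apE amE.
rewrite big_ord_recl big_ord0 /= expr0 mul1r addr0 linearDl linearZl_LR /=.
rewrite !tensor_gram /qgram /= add0r.
(* The vacuum has norm 1: its Gram sum runs over the single permutation of the empty set. *)
rewrite (big_pred1 (1%g : 'S_0)) => [|w]; last first.
  by rewrite /= (_ : w = 1%g) ?eqxx//; apply/perm.permP => -[].
rewrite big_ord0 mul1r (_ : inversions _ = 0%N) ?expr0 ?mulr1; last first.
  by apply: eq_card0 => -[[]].
by rewrite /rcdot /= linear0r.
Qed.

End Operators.

(** * Specialization to the full index set *)

Lemma cross_setC n (I : {set 'I_n}) :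
  cross I ([set: 'I_n] :\: I) = crossings I.
Proof.
rewrite setTD /crossings -sum1dep_card /cross /below pair_big_dep /=.
rewrite big_mkcond [RHS]big_mkcond /=; apply: eq_bigr => -[i j] _ /=.
by rewrite !inE; case: (i \in I); case: (j \in I) => //=; case: ltnP.
Qed.

Lemma weight_onT n (g : {set {set 'I_n}}) : weight_on [set: 'I_n] g = weight g.
Proof.
apply: eq_bigr => p _; congr (_ - _)%N.
by apply: eq_card => k; rewrite !inE.
Qed.

Theorem theorem3p1 (R : realType) (H0 : realHilbert R) (q : R)
    (hq : -1 < q < 1) (F : qFock H0 q) (ap am : H0 -> F -> F)
    (hap : forall f : H0, is_creation f (ap f))
    (ham : forall f : H0, is_annihilation f (am f))
    (n : nat) (hn : (0 < n)%N) (f : 'I_n -> H0) :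
  wick ap am f =
  \sum_(g in feynman n)
    ((-1) ^+ #|pairs g| * q%:C ^+ weight g) *: feynman_value ap am f g.
Proof.
pose apL i := linear_pack (hap (f i)).1.1.
pose amL i := linear_pack (ham (f i)).1.1.
pose e i j := (hdot H0 (f i) (f j))%:C.
have qcomm i j y : amL i (apL j y) = e i j *: y + q%:C *: apL j (amL i y).
  exact: (annihilation_creation hap ham).
apply: funext => x.
have := wick_on_feynman qcomm [set: 'I_n] x.
rewrite /wick_on /feynman_sum /wick !fct_sumE => wE.
transitivity (\sum_(I : {set 'I_n} | I \subset [set: 'I_n])
    q%:C ^+ cross I ([set: 'I_n] :\: I) *:
      compose (fun k => apL k) I
        (compose (fun k => amL k) ([set: 'I_n] :\: I) x)).
  apply: eq_big => I; first by rewrite subsetT.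
  move=> _; rewrite cross_setC.
  have -> : \big[@opmul R H0 q F/idfun]_(j < n | j \notin I) am (f j) =
      \big[@opmul R H0 q F/idfun]_(j in [set: 'I_n] :\: I) am (f j).
    by apply: eq_bigl => k; rewrite !inE andbT.
  (* Evaluating the scaled composite at x holds by conversion and exposes the two products to
     [big_opmul]. *)
  rewrite -[LHS]/(_ *: (\big[@opmul R H0 q F/idfun]_(i in I) ap (f i))
    ((\big[@opmul R H0 q F/idfun]_(j in [set: 'I_n] :\: I) am (f j)) x)).
  by rewrite !big_opmul.
rewrite wE; apply: eq_bigr => g _; rewrite /feynman_term.
rewrite -[RHS]/(_ *: (_ *:
  (\big[@opmul R H0 q F/idfun]_(h in Defs.singletons g) qgauss ap am (f h)) x)).
rewrite big_opmul scalerA weight_onT; congr (_ * _ *: _).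
by apply: eq_bigr => p _; rewrite (expect_qgauss hap ham).
Qed.
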